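(* Let $S\subseteq \mathbb N$ be such that its arithmetic density $d_S$ exists and satisfies $d_S>0$, and such that $f_S(q):=1+\sum_{n\in S}q^n$ is analytic and has no zeros on $\{q\in\mathbb C: |q|<1\}$. Then, as $q\to 1$ radially from within the unit disk, $$\lim_{q\to 1} F_S(q)\;=\;\lim_{q\to 1}\sum_{n=0}^{\infty} C_S(n)\,q^n\;=\;\frac{1}{d_S}.$$
   Context: $\mathbb N=\{1,2,3,\dots\}$. For $S\subseteq\mathbb N$, the arithmetic density is $d_S:=\lim_{N\to\infty}\#\{n\in S: n\le N\}/N$. A partition $\lambda$ is a finite multiset of positive integers (parts), including the empty partition; $|\lambda|$ is the sum of its parts, $\ell(\lambda)$ the number of parts, and $m_i=m_i(\lambda)$ the multiplicity of $i$ as a part. $\mathcal P_S$ denotes the set of partitions all of whose parts lie in $S$ (including the empty partition). Define $$C_S(n):=\sum_{\substack{\lambda\in\mathcal P_S\\ 0\le|\lambda|\le n}}\frac{(-1)^{\ell(\lambda)}\,\ell(\lambda)!}{m_1!\,m_2!\,m_3!\cdots m_n!},$$ (the empty partition contributes $1$), and $F_S(q):=\sum_{n\ge0}C_S(n)q^n$. *)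

(* Defs.v *)
From HB Require Import structures.
From mathcomp Require Export all_boot all_order all_algebra.
From mathcomp Require Export finmap multiset.
From mathcomp Require Export all_classical all_reals all_analysis.
From mathcomp Require Export complex.

Set Implicit Arguments.
Unset Strict Implicit.
Unset Printing Implicit Defensive.

Export Order.TTheory GRing.Theory Num.Theory.
Export numFieldNormedType.Exports.

Global Open Scope classical_set_scope.
Global Open Scope ring_scope.

(* [R[i]] itself carries no topology; its regular algebra [R[i]^o] has the one
   given by the modulus. *)
Notation Cplx R := (R[i]^o)%type.

Definition ofR (R : realType) (x : R) : Cplx R := (x%:C)%C.

Definition unit_disk (R : realType) : set (Cplx R) := [set q | `|q| < 1].

Definition density_ratio (R : realType) (S : set nat) (N : nat) : R :=
  #|[pred k : 'I_N.+1 | (k : nat) \in S]|%:R / N%:R.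

Definition density (R : realType) (S : set nat) : R :=
  limn (density_ratio R S).

Definition analytic_on (R : realType) (D : set (Cplx R))
    (f : Cplx R -> Cplx R) : Prop :=
  forall z, D z -> exists a : nat -> Cplx R,
    \forall w \near z, series (fun n => a n * (w - z) ^+ n) @ \oo --> f w.

Definition fS (R : realType) (S : set nat) (q : Cplx R) : Cplx R :=
  1 + limn (series (fun n => (n \in S)%:R * q ^+ n)).

(* A multiset [l] of naturals coerces to the sequence of its elements, and
   [l i] is the multiplicity of [i] in it. *)
Definition is_partition (l : {mset nat}%mset) : Prop := 0%N \notin l.

Definition weight (l : {mset nat}%mset) : nat := (\sum_(i <- l) i)%N.

Definition partitions_in (S : set nat) : set {mset nat}%mset :=
  [set l | is_partition l /\ forall i, i \in l -> S i].

Definition CS_term (R : realType) (n : nat) (l : {mset nat}%mset) : Cplx R :=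
  (-1) ^+ size l * (size l)`!%:R / \prod_(1 <= i < n.+1) (l i)`!%:R.

(* The sum over a set is 0 by convention when infinitely many terms are nonzero;
   this never happens here, see [finite_partitions_le]. *)
Definition CS (R : realType) (S : set nat) (n : nat) : Cplx R :=
  \sum_(l \in partitions_in S `&` [set l | (weight l <= n)%N]) CS_term R n l.

Definition FS_series (R : realType) (S : set nat) (q : Cplx R) :
    nat -> Cplx R :=
  series (fun n => CS R S n * q ^+ n).

Definition FS (R : realType) (S : set nat) (q : Cplx R) : Cplx R :=
  limn (FS_series S q).

Lemma finite_partitions_le (S : set nat) (n : nat) :
  finite_set (partitions_in S `&` [set l | (weight l <= n)%N]).
Proof.
pose g (s : n.-bseq 'I_n.+1) : {mset nat}%mset := seq_mset (map val s).
apply: (@sub_finite_set _ _ (g @` setT)); last first.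
  by apply: finite_image; exact: finite_finset.
move=> l [[l0 _] /= wl].
have hpos i : i \in enum_mset l -> (0 < i)%N.
  by move=> il; case: i il => // il; move: l0; rewrite /is_partition il.
have hle i : i \in enum_mset l -> (i <= n)%N.
  move=> il; apply: leq_trans wl; rewrite /weight (big_rem i) //=.
  exact: leq_addr.
have hs : (size (enum_mset l) <= n)%N.
  apply: leq_trans wl; rewrite /weight -sum1_size big_seq [leqRHS]big_seq.
  by apply: leq_sum => i /hpos.
pose t := [seq (inord i : 'I_n.+1) | i <- enum_mset l].
have ht : (size t <= n)%N by rewrite size_map.
exists (Bseq ht) => //=.
rewrite /g /= /t -map_comp.
rewrite (_ : map _ _ = enum_mset l); first exact: seq_mset_id.
rewrite -[RHS]map_id; apply/eq_in_map => i /hle il /=.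
by rewrite inordK.
Qed.

(* Main.v *)
(* Let C(n) be the coefficients of F_S.  Removing one part from a partition gives
   f_S(q) (1 - q) F_S(q) = 1 as formal power series, so F_S is the inverse of
   h(q) = (1 - q) f_S(q), whose coefficients are bounded by 1.

   Growth of C(n).  Suppose |C(n)| s^n is bounded for some s <= T < 1.  On |z| <= T
   the modulus of h is bounded below, so by the Leibniz rule the Taylor coefficients
   of 1/h at every z with |z| < s are at most M A^k, with M and A depending only on T.
   As the k-th one is the power series with coefficients binom(n, k) C(n), Cauchy's
   estimate (averaging over roots of unity) gives binom(n, k) |C(n)| r^n <= M A^k for
   r < s; multiplying by (2A)^-k and summing over k bounds |C(n)| (r (1 + 1/(2A)))^n.
   The gain is independent of s, so iterating it from s = 1/2 reaches T.  Everything
   is carried out on truncations, so that only polynomials are differentiated.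

   Limit.  Hence F_S(r) = 1 / ((1 - r) f_S(r)) on [0, 1), and Abel summation turns
   the density of S into (1 - r) f_S(r) --> d_S. *)

Require Import Defs.
From mathcomp Require Import separable cyclotomic cyclic ring lra zify.

Set Implicit Arguments.
Unset Strict Implicit.
Unset Printing Implicit Defensive.

Import ComplexField.Normc.

(** * Polynomials over the complex numbers *)

(** The sum [i + (N - n)] lies strictly between 0 and 2N, so the only multiple of N it can be is N.
    This isolates one index in the root-of-unity filter of [coef_le_circle]. *)
Lemma dvdn_addB_eq N i n :
  (i < N)%N -> (n < N)%N -> (N %| i + (N - n))%N -> i = n.
Proof.
move=> lt_iN lt_nN /dvdnP[[|[|q]]]; rewrite ?mulSn ?mul0n; lia.
Qed.

Section Modulus.
Variable R : rcfType.
Implicit Types x y z : R[i].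

Lemma normc_ge0 z : 0 <= normc z.
Proof. by case: z => a b; exact: sqrtr_ge0. Qed.

Lemma normc_normr z : `|z| = ((normc z)%:C)%C.
Proof. by rewrite normc_def; case: z. Qed.

Lemma normcX z n : normc (z ^+ n) = normc z ^+ n.
Proof.
elim: n => [|n IH]; first by rewrite !expr0 normc1.
by rewrite !exprS normcM IH.
Qed.

Lemma normc_real (a : R) : normc (a%:C)%C = `|a|.
Proof. by rewrite /= expr0n addr0 sqrtr_sqr. Qed.

Lemma normc_nat n : normc (n%:R : R[i]) = n%:R.
Proof. by rewrite -(rmorph_nat (real_complex R)) normc_real normr_nat. Qed.

Lemma le_normc_sum I (r : seq I) (P : pred I) (F : I -> R[i]) :
  normc (\sum_(i <- r | P i) F i) <= \sum_(i <- r | P i) normc (F i).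
Proof.
elim/big_rec2: _ => [|i y x _ le_xy]; first by rewrite normc0.
by apply: le_trans (le_normcD _ _) _; rewrite lerD2l.
Qed.

Lemma le_normcB x y : normc x - normc y <= normc (x - y).
Proof. by rewrite lerBlDr -{1}(subrK y x) le_normcD. Qed.

Lemma normc_distC x y : normc (x - y) = normc (y - x).
Proof. by rewrite -normcN opprB. Qed.

(** In characteristic zero X^n - 1 is separable, so it has n distinct roots, and n distinct n-th
    roots of unity in a field include a primitive one. *)
Lemma exists_prim_root n : (0 < n)%N -> exists w : R[i], n.-primitive_root w.
Proof.
move=> n_gt0; have n_neq0: n%:R != 0 :> R[i] by rewrite pnatr_eq0 -lt0n.
have [r Dp] := closed_field_poly_normal ('X^n - 1 : {poly R[i]}).
move: Dp; rewrite (monicP _) ?monicXnsubC // scale1r => Dp.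
have rn1 : all n.-unity_root r.
  by apply/allP => z; rewrite unity_rootE -root_prod_XsubC -Dp rootE !hornerE subr_eq0.
have sz_r : (n < (size r).+1)%N.
  by rewrite -(size_prod_XsubC r id) -Dp size_XnsubC.
have [|w] := hasP (has_prim_root n_gt0 rn1 _ sz_r).
  by rewrite -separable_prod_XsubC -Dp separable_Xn_sub_1.
by move=> _ Hw; exists w.
Qed.

Lemma sum_prim_root_exp n (w : R[i]) m : n.-primitive_root w ->
  \sum_(j < n) w ^+ (m * j) = ((n %| m)%N)%:R * n%:R.
Proof.
move=> wP; case: (boolP (n %| m)%N) => nm.
  under eq_bigr do rewrite exprM (eqP (_ : w ^+ m == 1)) ?expr1n -?(prim_order_dvd wP) //.
  by rewrite sumr_const card_ord mul1r.
rewrite mul0r; have wm1 : w ^+ m - 1 != 0.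
  by rewrite subr_eq0 -(prim_order_dvd wP).
apply: (mulfI wm1); rewrite mulr0.
under eq_bigr do rewrite exprM.
by rewrite -subrX1 -exprM mulnC exprM (prim_expr_order wP) expr1n subrr.
Qed.

Lemma normc_prim_root n (w : R[i]) : n.-primitive_root w -> normc w = 1.
Proof.
move=> wP; apply/eqP.
rewrite -(@eqrXn2 _ n) ?(prim_order_gt0 wP) ?normc_ge0 ?ler01 //.
by rewrite -normcX (prim_expr_order wP) normc1 expr1n.
Qed.

(** Cauchy's estimate with a finite average for the contour integral: [size p] equidistant points on
    the circle are enough to separate all coefficients. *)
Lemma coef_le_circle (p : {poly R[i]}) (r M : R) n : 0 <= r ->
    (forall z, normc z = r -> normc p.[z] <= M) ->
  normc p`_n * r ^+ n <= M.
Proof.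
move=> r_ge0 pM; have [sz|n_lt] := leqP (size p) n.
  (* The coefficient is zero here, and M is nonnegative because it bounds a modulus at the point
     r. *)
  rewrite nth_default // normc0 mul0r; apply: le_trans (normc_ge0 p.[(r%:C)%C]) _.
  by apply: pM; rewrite normc_real ger0_norm.
set N := size p in n_lt.
have N_gt0 : (0 < N)%N by apply: leq_ltn_trans n_lt.
have [w wP] := exists_prim_root N_gt0.
pose rC : R[i] := (r%:C)%C.
(* Since w^N = 1, the exponent [N - n] acts as -n without negative powers. *)
have key : \sum_(j < N) p.[rC * w ^+ j] * w ^+ ((N - n) * j) = N%:R * (p`_n * rC ^+ n).
  under eq_bigr => j _ do rewrite horner_coef mulr_suml.
  rewrite exchange_big /= (bigD1 (Ordinal n_lt)) //= [X in _ + X]big1 ?addr0.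
    under eq_bigr => j _ do
      rewrite exprMn -exprM -!mulrA -exprD (mulnC j) -mulnDl subnKC 1?ltnW // mulrA.
    by rewrite -mulr_sumr (sum_prim_root_exp _ wP) dvdnn mul1r mulrC.
  move=> i ne_in.
  under eq_bigr => j _ do
    rewrite exprMn -exprM -!mulrA -exprD (mulnC j) -mulnDl mulrA.
  rewrite -mulr_sumr (sum_prim_root_exp _ wP) (_ : (_ %| _)%N = false) ?mul0r ?mulr0 //.
  apply/negbTE; apply: contra ne_in => dvd; apply/eqP/val_inj => /=.
  exact: dvdn_addB_eq (ltn_ord i) n_lt dvd.
have : normc (N%:R * (p`_n * rC ^+ n)) <= N%:R * M.
  rewrite -key; apply: le_trans (le_normc_sum _ _ _) _.
  rewrite mulr_natl -[X in _ <= M *+ X](card_ord N) -sumr_const; apply: ler_sum => j _.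
  rewrite normcM !normcX (normc_prim_root wP) expr1n mulr1; apply: pM.
  by rewrite normcM normcX (normc_prim_root wP) expr1n mulr1 normc_real ger0_norm.
rewrite !normcM normc_nat normcX normc_real (ger0_norm r_ge0).
by rewrite ler_pM2l // ltr0n.
Qed.

End Modulus.

(** Hasse derivatives are divided by k!, so the Leibniz rule has no binomial coefficients. *)
Lemma nderivnM (R : comNzRingType) (p q : {poly R}) k :
  (p * q)^`N(k) = \sum_(j < k.+1) p^`N(j) * q^`N(k - j).
Proof.
elim/poly_ind: p k => [|p c IH] k.
  by rewrite mul0r linear0 big1 // => j _; rewrite linear0 mul0r.
case: k => [|k]; first by rewrite big_ord1 !nderivn0.
have -> : (p * 'X + c%:P) * q = (p * q * 'X + 0%:P) + c *: q.
  by rewrite polyC0 addr0 mulrDl mul_polyC mulrAC.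
rewrite nderivnD nderivnMXaddC nderivnZ !IH.
rewrite [X in _ + X * 'X]big_ord_recl [RHS]big_ord_recl /= !subn0 !nderivn0.
under [X in _ = _ + X]eq_bigr => j _ do
  rewrite nderivnMXaddC subSS mulrDl (mulrAC _ 'X).
rewrite big_split /= -mulr_suml -mul_polyC.
under [X in _ + (_ + X) * _]eq_bigr => j _ do rewrite subSS.
by ring.
Qed.

(** * Bounds on the Taylor coefficients of a polynomial *)

Section TaylorBound.
Variable R : rcfType.

(** A majorant of |p| on the disk of radius t, computed from the coefficients alone. *)
Definition poly_wnorm (t : R) (p : {poly R[i]}) := \sum_(i < size p) normc p`_i * t ^+ i.

Lemma poly_wnorm_widen (t : R) (p : {poly R[i]}) n : (size p <= n)%N ->
  poly_wnorm t p = \sum_(i < n) normc p`_i * t ^+ i.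
Proof.
move=> le_n; rewrite /poly_wnorm -!(big_mkord xpredT (fun i => normc p`_i * t ^+ i)).
rewrite [RHS](big_cat_nat _ le_n) //= [X in _ + X]big_nat_cond [X in _ + X]big1 ?addr0 //.
by move=> i /andP[/andP[le_i _] _]; rewrite nth_default // normc0 mul0r.
Qed.

Lemma bin_exp_le (x y : R) n k : 0 <= x -> 0 <= y ->
  'C(k + n, k)%:R * x ^+ n * y ^+ k <= (x + y) ^+ (k + n).
Proof.
move=> x0 y0; rewrite exprDn.
have lt_k : (k < (k + n).+1)%N by rewrite ltnS leq_addr.
rewrite (bigD1 (Ordinal lt_k)) //= addKn -[X in X <= _]addr0.
apply: lerD; first by rewrite -mulrA mulr_natl.
by apply: sumr_ge0 => i _; rewrite mulrn_wge0 // mulr_ge0 // exprn_ge0.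
Qed.

(** In the binomial expansion of each (|z| + t)^i, the term in t^k alone dominates the contribution
    of the i-th coefficient to the left side. *)
Lemma nderivn_le_wnorm (p : {poly R[i]}) k z (t : R) : 0 <= t ->
  normc p^`N(k).[z] * t ^+ k <= poly_wnorm (normc z + t) p.
Proof.
move=> t0; rewrite (@poly_wnorm_widen _ _ (k + size p)) ?leq_addl //.
have le_sz : (size p^`N(k) <= size p)%N.
  by apply: leq_trans (size_poly _ _) _; rewrite leq_subr.
rewrite (horner_coef_wide _ le_sz) big_split_ord /=.
apply: (@le_trans _ _ (0 + \sum_(i < size p)
  normc p`_(k + i) * (normc z + t) ^+ (k + i))); last first.
  rewrite lerD2r; apply: sumr_ge0 => i _.
  by rewrite mulr_ge0 ?normc_ge0 // exprn_ge0 // addr_ge0 ?normc_ge0.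
rewrite add0r; apply: le_trans (ler_wpM2r (exprn_ge0 _ t0) (le_normc_sum _ _ _)) _.
rewrite mulr_suml; apply: ler_sum => i _.
rewrite coef_nderivn normcM normcX -mulr_natr normcM normc_nat -!mulrA.
rewrite ler_wpM2l ?normc_ge0 // mulrA.
exact: bin_exp_le (normc_ge0 _) t0.
Qed.

End TaylorBound.

(** * Growth of the inverse of a power series *)

Section GeometricEstimates.
Variable R : realType.
Implicit Types x e : R.

Lemma sum_geometric_le x n : 0 <= x < 1 -> \sum_(i < n) x ^+ i <= (1 - x)^-1.
Proof.
move=> /andP[x0 x1]; have x1' : 0 < 1 - x by rewrite subr_gt0.
rewrite -[leRHS]mul1r ler_pdivlMr // mulrC -opprB mulNr -subrX1 opprB.
by rewrite gerBl exprn_ge0.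
Qed.

(* [x ^+ n] is the least of the [n.+1] terms of a geometric sum. *)
Lemma natr_expr_le x n : 0 <= x < 1 -> n.+1%:R * x ^+ n <= (1 - x)^-1.
Proof.
move=> /[dup] /andP[x0 x1] /(sum_geometric_le n.+1); apply: le_trans.
rewrite mulr_natl -[X in _ *+ X](card_ord n.+1) -sumr_const.
by apply: ler_sum => i _; apply: ler_wiXn2l => //; rewrite ?ltW // -ltnS.
Qed.

Lemma expr_eventually_le x K e : 0 <= x < 1 -> 0 < e ->
  exists N1, forall N, (N1 <= N)%N -> K * x ^+ N <= e.
Proof.
move=> /andP[x0 x1] e0.
have cv : K * x ^+ n @[n --> \oo] --> K * (0 : R).
  by apply: cvgMr; apply: cvg_expr; rewrite ger0_norm.
rewrite mulr0 in cv; move/cvgrPdist_le : cv => /(_ _ e0)[N1 _ HN1].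
exists N1 => N le_N; have /= := HN1 N le_N; rewrite sub0r normrN.
exact: le_trans (ler_norm _).
Qed.

End GeometricEstimates.

Section InverseSeries.
Variables (R : realType) (h c : nat -> R[i]).
Hypothesis h_le1 : forall n, normc (h n) <= 1.
Hypothesis hc1 : forall n, \sum_(i < n.+1) h i * c (n - i)%N = (n == 0%N)%:R.

Let hp N : {poly R[i]} := \poly_(i < N) h i.
Let cp N : {poly R[i]} := \poly_(i < N) c i.
(** The truncations are not exact inverses; [err N] collects the spurious terms, all of degree at
    least N. *)
Let err N : {poly R[i]} := hp N * cp N - 1.

Lemma coef_trunc_err_lt N d : (d < N)%N -> (err N)`_d = 0.
Proof.
move=> lt_dN; rewrite coefB coef1 coefM -hc1; apply/eqP; rewrite subr_eq0; apply/eqP.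
apply: eq_bigr => i _; rewrite !coef_poly.
by rewrite (leq_ltn_trans (leq_subr _ _) lt_dN) (leq_ltn_trans _ lt_dN) // -ltnS.
Qed.

(** The coefficient is a convolution of d + 1 products, each at most K once s^d is split between its
    two factors. *)
Lemma coef_trunc_err_le (s K : R) N d : (0 < N)%N -> 0 <= s <= 1 ->
    (forall n, normc (c n) * s ^+ n <= K) ->
  normc (err N)`_d * s ^+ d <= K * d.+1%:R.
Proof.
move=> N0 /andP[s0 s1] cK.
have K0 : 0 <= K.
  by apply: le_trans (cK 0%N); rewrite mulr_ge0 ?normc_ge0 ?exprn_ge0.
have [/coef_trunc_err_lt -> | le_Nd] := ltnP d N.
  by rewrite normc0 mul0r mulr_ge0.
rewrite coefB coef1 coefM (_ : (d == 0)%N = false) ?subr0; last first.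
  by apply/negbTE; rewrite -lt0n (leq_trans N0).
apply: le_trans (ler_wpM2r (exprn_ge0 _ s0) (le_normc_sum _ _ _)) _.
rewrite mulr_suml mulr_natr -[X in _ *+ X](card_ord d.+1) -sumr_const.
apply: ler_sum => i _; rewrite !coef_poly normcM.
have le_id : (i <= d)%N by rewrite -ltnS.
have -> : s ^+ d = s ^+ i * s ^+ (d - i) by rewrite -exprD subnKC.
rewrite mulrACA -[leRHS]mul1r.
apply: ler_pM; rewrite ?mulr_ge0 ?normc_ge0 ?exprn_ge0 //.
  rewrite -[leRHS]mul1r; apply: ler_pM; rewrite ?normc_ge0 ?exprn_ge0 ?exprn_ile1 //.
  by case: ifP => //; rewrite normc0 ler01.
by case: ifP => //; rewrite normc0 mul0r.
Qed.

Lemma wnorm_trunc_err_small (r s K e : R) : 0 <= r < s -> s <= 1 ->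
    (forall n, normc (c n) * s ^+ n <= K) -> 0 < e ->
  exists N1, forall N, (N1 <= N)%N -> poly_wnorm r (err N) <= e.
Proof.
move=> /andP[r0 rs] s1 cK e0.
have s0 : 0 < s by apply: le_lt_trans rs.
have K0 : 0 <= K.
  by apply: le_trans (cK 0%N); rewrite mulr_ge0 ?normc_ge0 ?exprn_ge0 ?ltW.
(* An intermediate radius: going from s down to s' absorbs the factor d + 1, and going from s' down
   to r leaves a geometric tail that starts at degree N. *)
pose s' := (r + s) / 2.
have s'0 : 0 < s' by rewrite /s'; lra.
have y01 : 0 <= s' / s < 1.
  by apply/andP; split; rewrite ?divr_ge0 ?(ltW s'0) ?(ltW s0) ?ltr_pdivrMr // /s'; lra.
have x01 : 0 <= r / s' < 1.
  by apply/andP; split; rewrite ?divr_ge0 ?(ltW s'0) ?(ltW s0) ?ltr_pdivrMr // /s'; lra.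
pose K' := K * (1 - s' / s)^-1.
have [N1 HN1] := expr_eventually_le (K' * (1 - r / s')^-1) x01 e0.
exists N1.+1 => N lt_N; apply: le_trans (HN1 N (ltnW lt_N)).
have N0 : (0 < N)%N by apply: leq_trans lt_N.
have K'0 : 0 <= K' by rewrite mulr_ge0 // invr_ge0 subr_ge0; case/andP: y01 => _ /ltW.
have coefK' d : normc (err N)`_d * r ^+ d <= K' * (r / s') ^+ d.
  rewrite expr_div_n mulrA ler_pdivlMr ?exprn_gt0 // mulrAC.
  apply: ler_wpM2r; first exact: exprn_ge0.
  have := coef_trunc_err_le d N0 _ cK; rewrite (ltW s0) s1 => /(_ isT) HK.
  have -> : s' ^+ d = s ^+ d * (s' / s) ^+ d by rewrite -exprMn mulrC divfK ?gt_eqF.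
  rewrite mulrA; apply: le_trans (ler_wpM2r _ HK) _.
    by apply: exprn_ge0; case/andP: y01.
  by rewrite -mulrA ler_wpM2l // natr_expr_le.
rewrite (@poly_wnorm_widen _ _ _ (N + size (err N))) ?leq_addl // big_split_ord /=.
rewrite big1 ?add0r => [|i _]; last by rewrite coef_trunc_err_lt ?normc0 ?mul0r.
apply: (@le_trans _ _ (\sum_(i < size (err N)) K' * (r / s') ^+ N * (r / s') ^+ i)).
  by apply: ler_sum => i _; rewrite -mulrA -exprD.
rewrite -mulr_sumr mulrAC ler_wpM2r ?exprn_ge0 //; first by case/andP: x01.
by rewrite ler_wpM2l // sum_geometric_le.
Qed.

Hypothesis h0 : h 0%N = 1.

(** Strong induction on the recurrence for c, using 1 + 2 + ... + 2^n < 2^(n+1). This gives the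
    starting radius 1/2 of the iteration. *)
Lemma inverse_series_le_exp2 n : normc (c n) <= 2 ^+ n.
Proof.
have [m] := ubnP n; elim: m n => // m IH [|n] lt_nm.
  by have := hc1 0; rewrite big_ord1 h0 mul1r => ->; rewrite normc1.
have /eqP := hc1 n.+1; rewrite big_ord_recl h0 mul1r addr_eq0 => /eqP -> /=.
rewrite normcN; apply: le_trans (le_normc_sum _ _ _) _.
apply: (@le_trans _ _ (\sum_(i < n.+1) 2 ^+ (n - i))).
  apply: ler_sum => i _; rewrite normcM -[leRHS]mul1r.
  apply: ler_pM; rewrite ?normc_ge0 //; apply: IH.
  by rewrite subSS; apply: leq_ltn_trans (leq_subr _ _) _.
rewrite (reindex_inj rev_ord_inj) /=.
rewrite (eq_bigr (fun i : 'I_n.+1 => 2 ^+ i)) => [|i _]; last first.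
  by rewrite subSS subKn // -ltnS.
have := subrX1 (2 : R) n.+1; rewrite (_ : 2 - 1 = 1 :> R); last by ring.
by rewrite mul1r => <-; rewrite gerBl.
Qed.

(** * One enlargement of the radius *)

Section Step.
Variables (T delta : R) (N0 : nat).
Hypotheses (T_gt0 : 0 < T) (T_lt1 : T < 1) (delta_gt0 : 0 < delta).
Hypothesis hp_ge : forall N z, (N0 <= N)%N -> normc z <= T -> delta <= normc (hp N).[z].

(** These constants depend only on T and delta: [tau] is half the distance from T to 1, M = 2/delta,
    and A is such that x = 1/(tau A) satisfies x/(1 - x) = tau delta/2, the value at which the
    Leibniz recursion closes. *)
Variables tau A M : R.
Hypotheses (tau_gt0 : 0 < tau) (tauE : 1 - (T + tau) = tau).
Hypotheses (ME : delta * M = 2) (AE : tau * A = 1 + 2 / (tau * delta)).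

Let Ttau_lt1 : T + tau < 1. Proof. by rewrite -subr_gt0 tauE. Qed.
Let M_gt0 : 0 < M. Proof. by rewrite -(pmulr_rgt0 _ delta_gt0) ME. Qed.
Let A_ge1 : 1 <= A.
Proof.
rewrite -(ler_pM2l tau_gt0) AE mulr1.
have : 0 < 2 / (tau * delta) by rewrite divr_gt0 ?mulr_gt0.
by move=> pos; have := T_gt0; have := tau_gt0; have := tauE; lra.
Qed.

(** A disk of radius [tau] around z stays inside radius T + tau, where coefficients bounded by 1
    give a sum of at most 1/(1 - (T + tau)) = 1/tau. *)
Lemma nderivn_trunc_le N k z : normc z <= T ->
  normc (hp N)^`N(k).[z] <= tau^-1 * tau ^- k.
Proof.
move=> zT; rewrite ler_pdivlMr ?exprn_gt0 // -[X in X^-1]tauE.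
apply: le_trans (nderivn_le_wnorm _ _ _ (ltW tau_gt0)) _.
rewrite (@poly_wnorm_widen _ _ _ N) ?size_poly //.
apply: le_trans (_ : \sum_(i < N) (T + tau) ^+ i <= _); last first.
  by apply: sum_geometric_le; rewrite Ttau_lt1 andbT addr_ge0 // ltW.
apply: ler_sum => i _; rewrite coef_poly ltn_ord -[leRHS]mul1r.
have zt0 : 0 <= normc z + tau by rewrite addr_ge0 ?normc_ge0 ?ltW.
apply: ler_pM; rewrite ?normc_ge0 ?exprn_ge0 //.
by apply: lerXn2r; rewrite ?nnegrE ?lerD2r // (le_trans zt0) ?lerD2r.
Qed.

(* [M A ^+ k] solves the recursion that the Leibniz rule gives for the Taylor
   coefficients of the inverse; the truncation error is eventually at most 1. *)
Lemma nderivn_inverse_le (r s K : R) k : 0 <= r < s -> s <= T ->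
    (forall n, normc (c n) * s ^+ n <= K) ->
  exists N1, forall N, (N1 <= N)%N -> forall j, (j <= k)%N ->
    forall z, normc z = r -> normc (cp N)^`N(j).[z] <= M * A ^+ j.
Proof.
move=> /andP[r0 rs] sT cK.
have step : forall k, exists N1, forall N, (N1 <= N)%N ->
    (forall j, (j < k)%N -> forall z, normc z = r -> normc (cp N)^`N(j).[z] <= M * A ^+ j) ->
    forall z, normc z = r -> normc (cp N)^`N(k).[z] <= M * A ^+ k.
  (* With r + t still below s, the truncation error has weighted norm at most t^k at radius r + t,
     so its k-th Taylor coefficient at z is at most 1. *)
  move=> {}k; pose t := (s - r) / 2; have t0 : 0 < t by rewrite /t; lra.
  have [|//||N1 HN1] := @wnorm_trunc_err_small (r + t) s K (t ^+ k) _ _ cK.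
  - by rewrite /t; lra.
  - by have := T_lt1; lra.
  - exact: exprn_gt0.
  exists (maxn N0 N1) => N; rewrite geq_max => /andP[le_N0 le_N1] IH z zr.
  have zT : normc z <= T by rewrite zr; lra.
  have hz := hp_ge le_N0 zT.
  have errz : normc (err N)^`N(k).[z] <= 1.
    rewrite -(ler_pM2r (exprn_gt0 k t0)) mul1r.
    apply: le_trans (nderivn_le_wnorm _ _ _ (ltW t0)) _.
    by rewrite zr; exact: HN1.
  (* The k-th Hasse derivative of [hp N * cp N = 1 + err N], solved for the term in which only the
     second factor is differentiated. *)
  have eqz : (hp N).[z] * (cp N)^`N(k).[z] = (k == 0)%:R + (err N)^`N(k).[z]
      - \sum_(j < k) (hp N)^`N(j.+1).[z] * (cp N)^`N(k - j.+1).[z].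
    apply/esym/eqP; rewrite subr_eq; apply/eqP.
    have <- : (hp N * cp N)^`N(k).[z] = (k == 0)%:R + (err N)^`N(k).[z].
      rewrite -{1}(subrK 1 (hp N * cp N)) -/(err N) nderivnD hornerD addrC.
      by rewrite nderivnC; case: (k == 0)%N; rewrite ?hornerC // horner0.
    rewrite nderivnM horner_sum big_ord_recl /= subn0 nderivn0 hornerM.
    by congr (_ + _); apply: eq_bigr => j _; rewrite hornerM.
  have sum_le : normc (\sum_(j < k) (hp N)^`N(j.+1).[z] * (cp N)^`N(k - j.+1).[z])
      <= (k != 0)%:R * A ^+ k.
    apply: le_trans (le_normc_sum _ _ _) _.
    case: k {HN1 errz eqz} IH => [|k] IH; first by rewrite big_ord0 mul0r.
    rewrite mul1r.
    have [x xE] : exists x, x = (tau * A)^-1 by exists (tau * A)^-1.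
    have tA1 : 1 < tau * A by rewrite AE ltrDl divr_gt0 ?mulr_gt0.
    (* By induction the j-th term is at most M A^(k+1) x^(j+1)/tau; the full geometric sum
       contributes x/(1 - x), and the constants multiply to exactly A^(k+1). *)
    apply: (@le_trans _ _ (\sum_(j < k.+1) (tau^-1 * M * A ^+ k.+1 * x) * x ^+ j)).
      apply: ler_sum => j _; rewrite normcM.
      apply: le_trans (_ : (tau^-1 * tau ^- j.+1) * (M * A ^+ (k.+1 - j.+1)) <= _).
        apply: ler_pM; rewrite ?normc_ge0 ?nderivn_trunc_le //.
        by apply: IH => //; rewrite subSS ltnS leq_subr.
      rewrite -[leRHS]mulrA -exprS xE exprVn exprMn.
      have le_j : (j.+1 <= k.+1)%N by [].
      have A0 : A != 0 by rewrite gt_eqF // (lt_le_trans ltr01).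
      have -> : A ^+ k.+1 = A ^+ (k.+1 - j.+1) * A ^+ j.+1 by rewrite -exprD subnK.
      rewrite invfM.
      rewrite le_eqVlt; apply/orP; left; apply/eqP.
      have AX0 : A ^+ j.+1 != 0 by rewrite expf_neq0.
      have tX0 : tau ^+ j.+1 != 0 by rewrite expf_neq0 // gt_eqF.
      move: (A ^+ j.+1) (tau ^+ j.+1) (A ^+ (k.+1 - j.+1)) AX0 tX0 => a b d a0 b0.
      by rewrite -[LHS]mulr1 -(divff a0); ring.
    rewrite -mulr_sumr.
    have x01 : 0 <= x < 1.
      by rewrite xE invr_ge0 (ltW (lt_trans ltr01 tA1)) invf_lt1 // (lt_trans ltr01).
    have cst0 : 0 <= tau^-1 * M * A ^+ k.+1 * x.
      rewrite mulr_ge0 ?(andP x01).1 // mulr_ge0 ?exprn_ge0 ?mulr_ge0 // ?ltW //.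
        by rewrite invr_gt0.
      exact: lt_le_trans ltr01 A_ge1.
    apply: le_trans (ler_wpM2l cst0 (sum_geometric_le _ x01)) _.
    rewrite le_eqVlt; apply/orP; left; apply/eqP.
    have d0 : delta != 0 by rewrite gt_eqF.
    have -> : M = 2 / delta by rewrite -ME mulrAC divff ?mul1r.
    have tau0 : tau != 0 by rewrite gt_eqF.
    have xx : x * (1 - x)^-1 = tau * delta / 2.
      have y0 : tau * A != 0 by rewrite gt_eqF // (lt_trans ltr01).
      have y1 : tau * A - 1 != 0 by rewrite gt_eqF // subr_gt0.
      have -> : x * (1 - x)^-1 = (tau * A - 1)^-1.
        rewrite xE; move: (tau * A) y0 y1 => y y0 y1.
        by field; rewrite y0 y1.
      by rewrite AE addrAC subrr add0r invf_div.
    rewrite -[LHS]mulrA xx; move: (A ^+ k.+1) => a.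
    by field; rewrite ?d0 ?tau0.
  (* The right side of [eqz] is at most 2 in modulus for k = 0 and at most 1 + A^k otherwise, so at
     most 2 A^k in both cases; hence the choice of M. *)
  have Ak1 : 1 <= A ^+ k by apply: exprn_ege1.
  suff : delta * normc (cp N)^`N(k).[z] <= delta * (M * A ^+ k) by rewrite ler_pM2l.
  have -> : delta * (M * A ^+ k) = 2 * A ^+ k by rewrite mulrA ME.
  apply: le_trans (ler_wpM2r (normc_ge0 _) hz) _; rewrite -normcM eqz.
  apply: le_trans (le_normcD _ _) _; rewrite normcN.
  apply: le_trans (lerD (le_normcD _ _) (lexx _)) _; rewrite normc_nat.
  by case: (k == 0)%N sum_le => /=; rewrite ?mul0r ?mul1r; lra.
elim: k => [|k [N1 HN1]].
  have [N1 HN1] := step 0%N; exists N1 => N le_N j; rewrite leqn0 => /eqP ->.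
  by apply: HN1.
have [N2 HN2] := step k.+1; exists (maxn N1 N2) => N; rewrite geq_max => /andP[le_N1 le_N2] j.
rewrite leq_eqVlt => /orP[/eqP -> | ]; last by rewrite ltnS; exact: HN1.
by apply: HN2 => // i; rewrite ltnS; exact: HN1.
Qed.

Lemma inverse_growth_le (s K : R) : 0 < s -> s <= T ->
    (forall n, normc (c n) * s ^+ n <= K) ->
  forall n, normc (c n) * (s * ((1 + (2 * A)^-1) / (1 + (4 * A)^-1))) ^+ n <= 2 * M.
Proof.
move=> s0 sT cK n.
have A0 : 0 < A by apply: lt_le_trans A_ge1.
have [t tE] : exists t, t = (2 * A)^-1 by exists (2 * A)^-1.
have t0 : 0 < t by rewrite tE invr_gt0 mulr_gt0.
have t2 : (4 * A)^-1 = t / 2.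
  by rewrite tE -invfM; congr _^-1; ring.
rewrite -tE t2.
(* The circle must lie strictly inside radius s. Dividing by 1 + t/2 loses less than the factor 1 +
   t gained below. *)
have [r rE] : exists r, r = s / (1 + t / 2) by exists (s / (1 + t / 2)).
have r0 : 0 < r by rewrite rE divr_gt0 // ltr_wpDr // ltW // divr_gt0.
have rs : r < s by rewrite rE ltr_pdivrMr ?ltr_pMr ?ltrDl ?ltr_wpDr ?divr_gt0 // ltW // divr_gt0.
have -> : s * ((1 + t) / (1 + t / 2)) = r * (1 + t) by rewrite rE mulrCA mulrC -mulrA mulrC.
have coef_le k : (k <= n)%N -> 'C(n, k)%:R * normc (c n) * r ^+ n <= M * A ^+ k.
  move=> le_kn; have [|N1 HN1] := @nderivn_inverse_le r s K k _ sT cK.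
    by rewrite ltW.
  have le1 := leq_maxl N1 n.+1; have le2 := leq_maxr N1 n.+1.
  have := coef_le_circle (n - k) (ltW r0) (HN1 _ le1 k (leqnn k)).
  rewrite coef_nderivn subnKC // coef_poly le2 -[c n *+ _]mulr_natl normcM normc_nat => le3.
  apply: le_trans le3; apply: ler_wpM2l; first by rewrite mulr_ge0 ?normc_ge0.
  apply: ler_wiXn2l; rewrite ?leq_subr ?(ltW r0) //.
  by apply: ltW; apply: lt_trans rs (le_lt_trans sT T_lt1).
(* Expanding (1 + t)^n brings in every [coef_le] at once; as A t = 1/2, the bounds sum to at most 2
   M. *)
rewrite exprMn mulrA addrC exprD1n mulr_sumr.
apply: (@le_trans _ _ (\sum_(i < n.+1) M * (2^-1) ^+ i)).
  apply: ler_sum => i _; have le_i : (i <= n)%N by rewrite -ltnS.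
  apply: le_trans (_ : (M * A ^+ i) * t ^+ i <= _).
    rewrite -mulr_natl mulrA; apply: ler_wpM2r; first by rewrite exprn_ge0 // ltW.
    by rewrite mulrC mulrA coef_le.
  rewrite -mulrA -exprMn tE invfM mulrCA divff ?mulr1 //.
  by rewrite gt_eqF.
rewrite -mulr_sumr mulrC; apply: ler_wpM2r; first exact: ltW.
apply: le_trans (sum_geometric_le _ _) _; first by apply/andP; split; lra.
by rewrite le_eqVlt; apply/orP; left; apply/eqP; field.
Qed.

End Step.

Hypothesis hp_lower : forall T, 0 < T -> T < 1 -> exists2 delta, 0 < delta &
  exists N0, forall N z, (N0 <= N)%N -> normc z <= T -> delta <= normc (hp N).[z].

Theorem inverse_series_growth T : 0 < T -> T < 1 ->
  exists K, forall n, normc (c n) * T ^+ n <= K.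
Proof.
move=> T0 T1; have [delta d0 [N0 HN0]] := hp_lower T0 T1.
have [tau tauE] : exists tau, tau = (1 - T) / 2 by exists ((1 - T) / 2).
have tau0 : 0 < tau by rewrite tauE divr_gt0 // subr_gt0.
have tau2 : 1 - (T + tau) = tau by rewrite tauE; field.
have [M ME] : exists M, delta * M = 2 by exists (2 / delta); rewrite mulrC divfK // gt_eqF.
have [A AE] : exists A, tau * A = 1 + 2 / (tau * delta).
  by exists ((1 + 2 / (tau * delta)) / tau); rewrite mulrC divfK // gt_eqF.
have step := inverse_growth_le T0 T1 d0 HN0 tau0 tau2 ME AE.
have A0 : 0 < A.
  by rewrite -(pmulr_rgt0 _ tau0) AE ltr_wpDr // ltW // divr_gt0 // mulr_gt0.
set u := _ / _ in step.
have u1 : 1 < u.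
  rewrite ltr_pdivlMr ?mul1r ?ltrD2l ?ltf_pV2 ?posrE ?mulr_gt0 //; first by rewrite ltr_pM2r // ltr_nat.
  by rewrite ltr_wpDr // ltW // invr_gt0 mulr_gt0.
have u0 : 0 < u by apply: lt_trans u1.
(* Each step multiplies the radius by u > 1; the minimum with T keeps it where the lower bound on h
   holds. *)
have grow m : exists K, forall n, normc (c n) * (Num.min T (2^-1 * u ^+ m)) ^+ n <= K.
  elim: m => [|m [K HK]].
    exists 1 => n; rewrite expr0 mulr1.
    apply: le_trans (_ : 2 ^+ n * (2^-1) ^+ n <= _); last first.
      by rewrite -exprMn divff ?expr1n.
    apply: ler_pM; rewrite ?normc_ge0 ?inverse_series_le_exp2 ?exprn_ge0 //.
      by rewrite le_min (ltW T0) invr_ge0 ler0n.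
    by apply: lerXn2r; rewrite ?nnegrE ?le_min ?(ltW T0) ?invr_ge0 ?ler0n //= ge_min lexx orbT.
  have m0 : 0 < Num.min T (2^-1 * u ^+ m) by rewrite lt_min T0 mulr_gt0 ?exprn_gt0.
  have mT : Num.min T (2^-1 * u ^+ m) <= T by rewrite ge_min lexx.
  exists (2 * M) => n; apply: le_trans (step _ _ m0 mT HK n).
  apply: ler_wpM2l; first exact: normc_ge0.
  apply: lerXn2r; rewrite ?nnegrE.
  - by rewrite le_min (ltW T0) mulr_ge0 // ltW // exprn_gt0.
  - by rewrite mulr_ge0 // ltW.
  rewrite minr_pMl ?(ltW u0) // le_min !ge_min exprSr mulrA lexx orbT andbT.
  by rewrite ler_peMr ?(ltW T0) // ltW.
have [m Hm] : exists m, T <= 2^-1 * u ^+ m.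
  have uV : 0 <= u^-1 < 1 by rewrite invr_ge0 (ltW u0) invf_lt1.
  have half0 : 0 < 2^-1 :> R by rewrite invr_gt0 ltr0n.
  have [N1 /(_ N1 (leqnn _)) HN1] := expr_eventually_le 1 uV half0.
  exists N1; apply: le_trans (ltW T1) _.
  by move: HN1; rewrite mul1r exprVn -[in X in X -> _](mul1r (_ ^-1)) ler_pdivrMr ?exprn_gt0.
by have [K HK] := grow m; exists K; move: HK; rewrite min_l.
Qed.
End InverseSeries.

(** * Complex limits and the minimum modulus *)

Section ComplexLimits.
Variable R : realType.

Lemma normc_le_ReIm (z : R[i]) : normc z <= `|complex.Re z| + `|complex.Im z|.
Proof.
have -> : z = ((complex.Re z)%:C)%C + 'i%C * ((complex.Im z)%:C)%C by rewrite -complexE.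
apply: le_trans (le_normcD _ _) _; rewrite normcM !normc_real.
have -> : normc 'i%C = 1 :> R by rewrite /= expr0n expr1n add0r sqrtr1.
by case: z => a b /=; rewrite !(mul0r, mulr0, mul1r, addr0, add0r, subr0) lexx.
Qed.

Lemma Re_le_normc (z : R[i]) : `|complex.Re z| <= normc z.
Proof. by case: z => a b /=; rewrite -sqrtr_sqr ler_wsqrtr // lerDl sqr_ge0. Qed.

Lemma Im_le_normc (z : R[i]) : `|complex.Im z| <= normc z.
Proof. by case: z => a b /=; rewrite -sqrtr_sqr ler_wsqrtr // lerDr sqr_ge0. Qed.

(** A positive element of [R[i]] has zero imaginary part, so real tolerances suffice. *)
Lemma cvg_complexP (T : Type) (F : set_system T) (FF : Filter F) (u : T -> Cplx R) (l : Cplx R) :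
  u @ F --> l <-> forall e : R, 0 < e -> \forall n \near F, normc (l - u n : R[i]) <= e.
Proof.
split.
  move=> /cvgrPdist_le ul e e0; have := ul (e%:C)%C; rewrite ltcR => /(_ e0).
  by apply: filterS => n; rewrite normc_normr lecR.
move=> ul; apply/cvgrPdist_le => -[e e'] /=; rewrite ltcE /= => /andP[/eqP -> e0].
by apply: filterS (ul e e0) => n; rewrite normc_normr lecR.
Qed.

Lemma cvgn_complexP (u : nat -> Cplx R) (l : Cplx R) :
  u @ \oo --> l <->
  forall e : R, 0 < e -> exists N, forall n, (N <= n)%N -> normc (l - u n : R[i]) <= e.
Proof.
split=> [/cvg_complexP ul e /ul [N _ HN]|ul].
  by exists N => n; exact: HN.
by apply/cvg_complexP => e /ul [N HN]; exists N.
Qed.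

Lemma real_cauchy_cvgn (v g : nat -> R) :
    (forall N n, (N <= n)%N -> `|v n - v N| <= g N) ->
    (forall e, 0 < e -> exists N, g N <= e) -> cvgn v.
Proof.
move=> vg g0; apply/cauchy_cvgP/cauchy_exP => e e0.
have e20 : 0 < e / 2 by rewrite divr_gt0.
have [N HN] := g0 _ e20; exists (v N); exists N => // n /= le_Nn.
rewrite /ball /= distrC; apply: le_lt_trans (vg _ _ le_Nn) _.
by apply: le_lt_trans HN _; lra.
Qed.

Lemma complex_cauchy_cvgn (u : nat -> Cplx R) (g : nat -> R) :
    (forall N n, (N <= n)%N -> normc (u n - u N : R[i]) <= g N) ->
    (forall e, 0 < e -> exists N, g N <= e) ->
  cvgn u.
Proof.
move=> ug g0.
have /cvg_ex[a ra] : cvgn (fun n => complex.Re (u n)).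
  apply: (real_cauchy_cvgn _ g0) => N n /ug; apply: le_trans.
  by rewrite -raddfB Re_le_normc.
have /cvg_ex[b rb] : cvgn (fun n => complex.Im (u n)).
  apply: (real_cauchy_cvgn _ g0) => N n /ug; apply: le_trans.
  by rewrite -raddfB Im_le_normc.
apply/cvg_ex; exists (a +i* b)%C; apply/cvg_complexP => e e0.
have e20 : 0 < e / 2 by rewrite divr_gt0.
move/cvgrPdist_le : ra => /(_ _ e20); move/cvgrPdist_le : rb => /(_ _ e20).
apply: filterS2 => n Hb Ha; apply: le_trans (normc_le_ReIm _) _.
by rewrite !raddfB /= (le_trans (lerD Ha Hb)) //; lra.
Qed.

Lemma lim_dist_le (u : nat -> Cplx R) (l : Cplx R) (z : R[i]) (e : R) N : u @ \oo --> l ->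
  (forall n, (N <= n)%N -> normc (u n - z : R[i]) <= e) -> normc (l - z : R[i]) <= e.
Proof.
move=> /cvgn_complexP ul ue; apply/ler_addgt0Pr => d d0.
have [N1 HN1] := ul _ d0.
have -> : (l - z : R[i]) = (u (maxn N N1) - z : R[i]) + (l - u (maxn N N1) : R[i]).
  by rewrite [RHS]addrC addrA subrK.
apply: le_trans (le_normcD _ _) _; apply: lerD; first by rewrite ue // leq_maxl.
by rewrite HN1 // leq_maxr.
Qed.

Lemma sum_tail_le (u : nat -> R[i]) (K x : R) N n : (N <= n)%N -> 0 <= x < 1 ->
    (forall i, normc (u i) <= K * x ^+ i) ->
  normc (\sum_(i < n) u i - \sum_(i < N) u i) <= K * x ^+ N / (1 - x).
Proof.
move=> le_Nn x01 uK; have /andP[x0 x1] := x01.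
have K0 : 0 <= K by have := uK 0%N; rewrite mulr1; apply: le_trans; exact: normc_ge0.
rewrite -(subnKC le_Nn) big_split_ord /= addrAC subrr add0r.
apply: le_trans (le_normc_sum _ _ _) _.
apply: (@le_trans _ _ (\sum_(i < n - N) (K * x ^+ N) * x ^+ i)).
  by apply: ler_sum => i _; rewrite -mulrA -exprD.
by rewrite -mulr_sumr ler_wpM2l ?sum_geometric_le // mulr_ge0 // exprn_ge0.
Qed.

End ComplexLimits.

(** * Power series with coefficients bounded by 1, and their minimum modulus *)

Section PowerSeries.
Variables (R : realType) (h : nat -> R[i]).
Hypothesis h_le1 : forall n, normc (h n) <= 1.

Let hp N : {poly R[i]} := \poly_(i < N) h i.

Definition pseries_lim (z : R[i]) : Cplx R := limn (fun N => (hp N).[z] : Cplx R).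

Lemma trunc_dist_le N n (z : R[i]) : (N <= n)%N -> normc z < 1 ->
  normc ((hp n).[z] - (hp N).[z]) <= normc z ^+ N / (1 - normc z).
Proof.
move=> le_Nn z1; rewrite !horner_poly -[leRHS]mul1r mulrA.
apply: (sum_tail_le (u := fun i => h i * z ^+ i) le_Nn); rewrite ?normc_ge0 // => i.
by rewrite normcM normcX ler_wpM2r // exprn_ge0 // normc_ge0.
Qed.

Lemma pseries_cvg (z : R[i]) : normc z < 1 ->
  (fun N => (hp N).[z] : Cplx R) @ \oo --> pseries_lim z.
Proof.
move=> z1; apply: (@complex_cauchy_cvgn _ _ (fun N => normc z ^+ N / (1 - normc z))).
  by move=> N n le_Nn; exact: trunc_dist_le.
move=> e e0; have [|N HN] := @expr_eventually_le _ (normc z) (1 - normc z)^-1 e _ e0.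
  by rewrite normc_ge0.
by exists N; rewrite mulrC HN.
Qed.

(** Uniform on |z| <= T: this carries continuity and lower bounds between the limit and its
    truncations. *)
Lemma pseries_dist_le (T : R) (z : R[i]) N : normc z <= T -> T < 1 ->
  normc (pseries_lim z - (hp N).[z] : R[i]) <= T ^+ N / (1 - T).
Proof.
move=> zT T1; have z1 := le_lt_trans zT T1; have T0 := le_trans (normc_ge0 _) zT.
apply: (lim_dist_le (N := N) (pseries_cvg z1)) => n le_Nn.
apply: le_trans (trunc_dist_le le_Nn z1) _.
apply: ler_pM; rewrite ?invr_ge0 ?exprn_ge0 ?subr_ge0 ?normc_ge0 ?(ltW z1) //.
  by apply: lerXn2r; rewrite ?nnegrE ?normc_ge0.
by rewrite lef_pV2 ?posrE ?subr_gt0 // lerD2l lerN2.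
Qed.

Lemma normc_subXX_le (z w : R[i]) n : normc z <= 1 -> normc w <= 1 ->
  normc (z ^+ n - w ^+ n) <= n%:R * normc (z - w).
Proof.
move=> z1 w1; rewrite subrXX normcM mulrC ler_wpM2r ?normc_ge0 //.
apply: le_trans (le_normc_sum _ _ _) _.
rewrite -[n in n%:R](card_ord n) -sumr_const.
apply: ler_sum => i _; rewrite normcM !normcX -[leRHS]mulr1.
by apply: ler_pM; rewrite ?exprn_ge0 ?exprn_ile1 ?normc_ge0.
Qed.

Lemma trunc_lipschitz N (z w : R[i]) : normc z <= 1 -> normc w <= 1 ->
  normc ((hp N).[z] - (hp N).[w]) <= (\sum_(i < N) i%:R) * normc (z - w).
Proof.
move=> z1 w1; rewrite !horner_poly -sumrB mulr_suml.
apply: le_trans (le_normc_sum _ _ _) _; apply: ler_sum => i _.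
rewrite -mulrBr normcM -[leRHS]mul1r.
by apply: ler_pM; rewrite ?normc_ge0 // normc_subXX_le.
Qed.

Lemma pseries_continuous_disk (T e : R) : 0 <= T < 1 -> 0 < e ->
  exists2 d : R, 0 < d & forall z w : R[i], normc z <= T -> normc w <= T ->
    normc (z - w) <= d -> normc (pseries_lim z - pseries_lim w : R[i]) <= e.
Proof.
move=> /[dup] T01 /andP[T0 T1] e0.
have e30 : 0 < e / 3 by rewrite divr_gt0.
have [N /(_ N (leqnn N)) HN] := @expr_eventually_le _ T (1 - T)^-1 _ T01 e30.
(* A Lipschitz constant of the truncation, increased by 1 so that it can be divided by. *)
have [L LE] : exists L, L = 1 + \sum_(i < N) (i%:R : R) by eexists.
have L0 : 0 < L by rewrite LE ltr_wpDr // sumr_ge0.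
exists (e / 3 / L); first by rewrite divr_gt0.
move=> z w zT wT zw.
have -> : (pseries_lim z - pseries_lim w : R[i]) = (pseries_lim z - (hp N).[z] : R[i])
    + ((hp N).[z] - (hp N).[w]) + ((hp N).[w] - pseries_lim w : R[i]).
  by rewrite /=; ring.
apply: le_trans (le_normcD _ _) _; apply: le_trans (lerD (le_normcD _ _) (lexx _)) _.
rewrite [X in _ + X]normc_distC.
have Hz := pseries_dist_le N zT T1; have Hw := pseries_dist_le N wT T1.
have Hzw : normc ((hp N).[z] - (hp N).[w]) <= e / 3.
  apply: le_trans (trunc_lipschitz _ _ _) _; rewrite ?(le_trans _ (ltW T1)) //.
  apply: le_trans (_ : L * normc (z - w) <= _); last by rewrite mulrC -ler_pdivlMr.
  by rewrite ler_wpM2r ?normc_ge0 // LE lerDr.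
rewrite mulrC in HN.
apply: (le_trans (lerD (lerD (le_trans Hz HN) Hzw) (le_trans Hw HN))); lra.
Qed.

(** The closed disk is viewed in [R * R], as a closed subset of a compact square, and the extreme
    value theorem is applied to the modulus. *)
Lemma pseries_min (T : R) : 0 <= T < 1 -> exists2 z0 : R[i], normc z0 <= T &
  forall z : R[i], normc z <= T ->
    normc (pseries_lim z0 : R[i]) <= normc (pseries_lim z : R[i]).
Proof.
move=> /[dup] T01 /andP[T0 T1].
pose cx (p : R * R) : R[i] := (p.1 +i* p.2)%C.
pose D : set (R * R) := [set p | normc (cx p) <= T].
have normE p : normc (cx p) <= T <-> p.1 ^+ 2 + p.2 ^+ 2 <= T ^+ 2.
  rewrite /= -{1}(ger0_norm T0) -sqrtr_sqr ler_sqrt ?sqr_ge0 //.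
have D0 : D !=set0.
  by exists (0, 0); apply/normE; rewrite /= !expr0n addr0 sqr_ge0.
have cD : compact D.
  apply: (@subclosed_compact _ _ (`[- T, T]%classic `*` `[- T, T]%classic)).
  - have -> : D = (fun p : R * R => p.1 ^+ 2 + p.2 ^+ 2) @^-1` [set x | x <= T ^+ 2].
      by apply/seteqP; split=> p /normE.
    apply: preimage_closed; last exact: closed_le.
    move=> p _; apply: cvgD.
      by apply: (@cvg_comp _ _ _ fst (fun x : R => x ^+ 2)); [exact: cvg_fst|exact: exprn_continuous].
    by apply: (@cvg_comp _ _ _ snd (fun x : R => x ^+ 2)); [exact: cvg_snd|exact: exprn_continuous].
  - by apply: compact_setX; exact: segment_compact.
  move=> p Dp /=; split; rewrite /= in_itv /= -ler_norml.
    exact: le_trans (Re_le_normc (cx p)) Dp.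
  exact: le_trans (Im_le_normc (cx p)) Dp.
have contG : {within D, continuous (fun p => normc (pseries_lim (cx p) : R[i]))}.
  apply/subspace_continuousP => p Dp; apply/cvgrPdist_le => e e0.
  have [d d0 Hd] := pseries_continuous_disk T01 e0.
  rewrite near_withinE.
  have d20 : 0 < d / 2 by rewrite divr_gt0.
  have : \forall q \near p, ball p (d / 2) q by exact: nbhsx_ballx.
  apply: filterS => q [q1 q2] Dq.
  have pq : normc (cx p - cx q) <= d.
    apply: le_trans (normc_le_ReIm _) _; rewrite !raddfB /=.
    by have := lerD (ltW q1) (ltW q2); rewrite -splitr.
  have := Hd _ _ Dp Dq pq => H1.
  have pq' : normc (cx q - cx p) <= d by rewrite normc_distC.
  have := Hd _ _ Dq Dp pq' => H2.
  rewrite ler_norml lerNl opprB.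
  by rewrite (le_trans (le_normcB _ _) H1) (le_trans (le_normcB _ _) H2).
have [p Dp Hp] := compact_EVT_min D0 cD contG.
exists (cx p); first by rewrite inE in Dp.
move=> [a b] zT; apply: (Hp (a, b)); rewrite inE; exact: zT.
Qed.

(** The absence of zeros makes the minimum modulus m positive; uniformly close truncations then keep
    at least m/2. *)
Lemma trunc_lower_bound (T : R) : 0 < T -> T < 1 ->
    (forall z, normc z < 1 -> pseries_lim z != 0) ->
  exists2 delta, 0 < delta & exists N0, forall N z, (N0 <= N)%N -> normc z <= T ->
    delta <= normc (hp N).[z].
Proof.
move=> T0 T1 Hn0; have T01 : 0 <= T < 1 by rewrite ltW.
have [z0 z0T Hmin] := pseries_min T01.
have m0 : 0 < normc (pseries_lim z0 : R[i]).
  rewrite lt_neqAle normc_ge0 andbT eq_sym; apply/eqP => /eq0_normc /eqP.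
  by apply/negP; apply: Hn0; apply: le_lt_trans T1.
set m := normc (pseries_lim z0 : R[i]) in m0 Hmin.
exists (m / 2); first by rewrite divr_gt0.
have m20 : 0 < m / 2 by rewrite divr_gt0.
have [N0 HN0] := @expr_eventually_le _ T (1 - T)^-1 _ T01 m20.
exists N0 => N z le_N zT; have H1 := Hmin z zT.
have H2 := pseries_dist_le N zT T1; have := HN0 N le_N; rewrite mulrC => H3.
have := le_normcB (pseries_lim z : R[i]) (pseries_lim z - (hp N).[z] : R[i]).
by rewrite opprB addrCA subrr addr0 => H4; lra.
Qed.

End PowerSeries.

(** * Partitions *)

Section Partitions.
Local Open Scope mset_scope.
Implicit Types (l m : {mset nat}) (i n : nat).

Lemma perm_mset1D i m : perm_eq (i +` m : {mset nat}) (i :: enum_mset m).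
Proof. by apply/eq_seq_msetP; rewrite seq_mset_id mset_cons seq_mset_id. Qed.

Lemma size_mset1D i m : size (i +` m) = (size m).+1.
Proof. by rewrite (perm_size (perm_mset1D i m)). Qed.

Lemma weight_mset1D i m : weight (i +` m) = (i + weight m)%N.
Proof. by rewrite /weight (perm_big _ (perm_mset1D i m)) big_cons. Qed.

Lemma le_weight l i : i \in l -> (i <= weight l)%N.
Proof. by move=> il; rewrite -(msetB1K il) weight_mset1D leq_addr. Qed.

Lemma sum_count_mem (s : seq nat) n : all (fun i => (i < n)%N) s ->
  (\sum_(i < n) count_mem (i : nat) s)%N = size s.
Proof.
elim: s => [_|x s IH /= /andP[xn sn]]; first by rewrite big1.
rewrite big_split /= IH // (bigD1 (Ordinal xn)) //= eqxx big1 // => i.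
by rewrite -val_eqE /= eq_sym => /negbTE ->.
Qed.

Lemma sum_multiplicity l n : (weight l <= n)%N ->
  (\sum_(i < n.+1) l i)%N = size l.
Proof.
move=> ln; rewrite -(@sum_count_mem (enum_mset l) n.+1).
  by apply: eq_bigr => i _; rewrite count_mem_mset.
by apply/allP => i il; rewrite ltnS (leq_trans (le_weight il)).
Qed.

End Partitions.

(** * The recurrence for C_S *)

Section Combinatorics.
Variables (R : realType) (S : set nat).
Hypothesis S_pos : S `<=` [set n | (0 < n)%N].
Local Open Scope mset_scope.
Implicit Types (l m : {mset nat}) (i n : nat).

Let parts n : set {mset nat} := partitions_in S `&` [set l | (weight l <= n)%N].

(** Multiplicities beyond the weight are zero and 0! = 1. Removing a part changes the weight bound,
    hence the upper limit of this product. *)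
Lemma CS_term_widen n n' l : (weight l <= n)%N -> (n <= n')%N ->
  CS_term R n' l = CS_term R n l.
Proof.
move=> ln nn'; rewrite /CS_term (big_cat_nat (n := n.+1)) //=.
rewrite [X in _ / (_ * X)]big_nat_cond [X in _ / (_ * X)]big1 ?mulr1 //.
move=> i /andP[/andP[ni _] _]; rewrite (mset_eq0P _) //.
by apply/negP => /le_weight /leq_trans /(_ ln); rewrite leqNgt ni.
Qed.

Lemma prod_fact_mset1D n i m : (0 < i <= n)%N ->
  \prod_(1 <= j < n.+1) ((i +` m)%mset j)`!%:R =
  (m i).+1%:R * \prod_(1 <= j < n.+1) (m j)`!%:R :> Cplx R.
Proof.
move=> /andP[i0 ile].
rewrite (bigD1_seq i) ?mem_index_iota ?i0 ?ltnS //= ?iota_uniq //.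
rewrite [in RHS](bigD1_seq i) ?mem_index_iota ?i0 ?ltnS //= ?iota_uniq //.
rewrite mset1DE eqxx /= factS natrM -mulrA; congr (_ * (_ * _)).
by apply: eq_bigr => j /negbTE ji; rewrite mset1DE ji.
Qed.

(** Dropping one i flips the sign, divides the factorial of the length by the length and that of the
    multiplicity by the multiplicity; the identity is stated free of division. *)
Lemma CS_term_removal n i l : (0 < i <= n)%N -> i \in l ->
  CS_term R n (l `\ i) * (size l)%:R = - (CS_term R n l * (l i)%:R).
Proof.
move=> i0n il; rewrite -{2 3 4}(msetB1K il); move: (l `\ i) => m.
rewrite /CS_term size_mset1D prod_fact_mset1D // mset1DE eqxx add1n.
have nz : \prod_(1 <= j < n.+1) (m j)`!%:R != 0 :> Cplx R.
  by rewrite prodf_seq_neq0; apply/allP => j _; rewrite pnatr_eq0 -lt0n fact_gt0.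
rewrite factS natrM exprS.
have nz2 : (m i).+1%:R != 0 :> Cplx R by rewrite pnatr_eq0.
move: (\prod_(_ <= _ < _) _) nz (m i).+1%:R nz2 => p nz a nz2.
by field; rewrite nz nz2.
Qed.

(** Up to sign the term counts the orderings of the parts of l, here sorted by their first part.
    Formally, the removal identity is summed over i, the multiplicities adding up to the length. *)
Lemma CS_term_rec n l : l != mset0 -> is_partition l -> (weight l <= n)%N ->
  CS_term R n l = - \sum_(i < n.+1) (if (i : nat) \in l then CS_term R n (l `\ (i : nat)) else 0).
Proof.
move=> l0 pl ln.
have sl : (size l)%:R != 0 :> Cplx R by rewrite pnatr_eq0 size_mset_eq0.
apply: (mulIf sl); rewrite -{1}(sum_multiplicity ln) mulNr mulr_suml -sumrN.
rewrite natr_sum mulr_sumr; apply: eq_bigr => i _.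
case: ifP => il; last by rewrite mul0r oppr0 (mset_eq0P _) ?il ?mulr0.
have i0 : (0 < i)%N by rewrite lt0n; apply: contraNneq pl => <-.
by rewrite CS_term_removal ?opprK // i0 /= -ltnS.
Qed.

Lemma parts_mset1D n i : S i -> (i <= n)%N ->
  set_bij (parts (n - i)) ((parts n `\ mset0) `&` [set l : {mset nat} | i \in l])%classic (fun m => i +` m).
Proof.
move=> Si ile; split.
- move=> m /= [[m0 mS] wm]; split; last exact: mset1D1.
  split; last first.
    by move=> /= /(congr1 (fun l : {mset nat} => i \in l)); rewrite mset1D1 in_mset0.
  split; last by rewrite /= weight_mset1D; move: wm => /=; lia.
  split; first by rewrite /is_partition in_mset1D negb_or m0 andbT eq_sym -lt0n; exact: S_pos.
  by move=> j; rewrite in_mset1D => /orP[/eqP -> //|]; exact: mS.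
- by move=> m m' _ _ /(congr1 (fun l => l `\ i)); rewrite !msetD1K.
- move=> l /= [[[[l0 lS] wl] _] il]; exists (l `\ i); last by rewrite msetB1K.
  have sub j : j \in l `\ i -> j \in l by rewrite in_msetB1 => /andP[].
  split; last by move: wl; rewrite /= -{1}(msetB1K il) weight_mset1D; lia.
  split; last by move=> j /sub /lS.
  by apply: contra l0 => /sub.
Qed.

(** The coefficient form of f_S(q) F_S(q) = 1/(1 - q): the empty partition gives 1, and all other
    terms cancel against those with one part removed. *)
Lemma CS_rec n :
  CS R S n + \sum_(i < n.+1) ((i : nat) \in S)%:R * CS R S (n - i) = 1.
Proof.
have fin k : finite_set (parts k) by exact: finite_partitions_le.
have fin0 : finite_set (parts n `\ mset0)%classic by apply: sub_finite_set (fin n) => x [].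
have P0 : parts n mset0.
  split; last by rewrite /= /weight enum_mset0 big_nil.
  by split=> [|i]; rewrite /is_partition ?in_mset0.
have T0 : CS_term R n mset0 = 1.
  rewrite /CS_term size_mset0 fact0 expr0 big1 ?divr1 ?mulr1 // => i _.
  by rewrite mset0E fact0.
rewrite {1}/CS (fsbigD1 mset0 _ _ (fin n) P0) T0 -addrA.
rewrite -[RHS]addr0; congr (_ + _).
rewrite (eq_fsbigr (fun l => - \sum_(i < n.+1)
    (if (i : nat) \in l then CS_term R n (l `\ (i : nat)) else 0))); last first.
  move=> l; rewrite inE => -[[[pl _] wl] /eqP l0].
  by apply: CS_term_rec.
(* After the exchange the removed part i is fixed, and the two sums are compared for each i. *)
rewrite fsbig_finite //= sumrN exchange_big /= addrC -sumrB big1 // => i _.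
apply/eqP; rewrite subr_eq0; apply/eqP; rewrite -fsbig_finite //=.
have ile : (i <= n)%N by rewrite -ltnS.
case: (boolP ((i : nat) \in S)) => [|/negP iS].
  rewrite inE => Si.
  transitivity (\sum_(l \in ((parts n `\ mset0) `&` [set l : {mset nat} | (i : nat) \in l])%classic)
      CS_term R n (l `\ (i : nat))); last first.
    rewrite fsbig_mkcondr; apply: eq_fsbigr => l _.
    by congr (if _ then _ else _); apply/idP/idP; rewrite inE.
  rewrite (reindex_fsbig _ _ _ _ (parts_mset1D Si ile)) mul1r.
  apply: eq_fsbigr => m; rewrite inE => -[_ wm].
  by rewrite msetD1K; symmetry; apply: CS_term_widen => //; exact: leq_subr.
rewrite mul0r fsbig1 // => l [[[_ lS] _] _].
by case: ifP => // /lS Si; case: iS; rewrite inE.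
Qed.

End Combinatorics.

(** * Abel summation and density *)

Section Abel.
Variable R : realType.
Implicit Types (b : nat -> R) (r : R).

Lemma abel_summation b r N :
  \sum_(n < N) b n * r ^+ n =
  (1 - r) * (\sum_(n < N) (\sum_(i < n.+1) b i) * r ^+ n) + (\sum_(i < N) b i) * r ^+ N.
Proof.
elim: N => [|N IH]; first by rewrite !big_ord0 mulr0 mul0r addr0.
rewrite big_ord_recr /= IH [in RHS]big_ord_recr /= [\sum_(i < N.+1) b i]big_ord_recr /= exprS.
by ring.
Qed.

(** Abel summation turns the slope e of the partial sums into at most e, while the constant K
    acquires a factor 1 - r that vanishes at 1. *)
Lemma abel_bound b r e K N : 0 <= r < 1 ->
    (forall n, `|\sum_(i < n) b i| <= e * n%:R + K) ->
  `|(1 - r) * \sum_(n < N) b n * r ^+ n| <= (1 - r ^+ N) * e + K * (1 - r).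
Proof.
move=> /andP[r0 r1] bK; have r1' : 0 <= 1 - r by rewrite subr_ge0 ltW.
have geo : (1 - r) * \sum_(n < N) r ^+ n = 1 - r ^+ N.
  by rewrite -opprB mulNr -subrX1 opprB.
(* Equality case: [b] has partial sums [e n + K]. *)
have comp : (1 - r) * (\sum_(n < N) (e * n.+1%:R + K) * r ^+ n) + (e * N%:R + K) * r ^+ N
    = e * \sum_(n < N) r ^+ n + K.
  elim: N {geo} => [|N IH]; first by rewrite !big_ord0 !mulr0 !add0r mulr1.
  rewrite !big_ord_recr /= !mulrDr -!addrA mulrC.
  have -> : e * \sum_(i < N) r ^+ i + (e * r ^+ N + K) =
    (e * \sum_(i < N) r ^+ i + K) + e * r ^+ N by ring.
  by rewrite -IH exprS -natr1; ring.
rewrite normrM (ger0_norm r1') abel_summation.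
apply: (@le_trans _ _ ((1 - r) * (e * \sum_(n < N) r ^+ n + K))); last first.
  by rewrite mulrDr mulrCA geo mulrC (mulrC K).
apply: ler_wpM2l => //; rewrite -comp.
apply: le_trans (ler_normD _ _) _; apply: lerD.
  rewrite normrM (ger0_norm r1'); apply: ler_wpM2l => //.
  apply: le_trans (ler_norm_sum _ _ _) _; apply: ler_sum => n _.
  by rewrite normrM (ger0_norm (exprn_ge0 _ r0)) ler_wpM2r // exprn_ge0.
by rewrite normrM (ger0_norm (exprn_ge0 _ r0)) ler_wpM2r // exprn_ge0.
Qed.

End Abel.

(** * The series (1 - q) f_S, its inverse F_S, and the density of S *)

Section DensitySeries.
Variables (R : realType) (S : set nat).
Hypothesis S_pos : S `<=` [set n | (0 < n)%N].

(* Coefficients of [f_S] and of [(1 - q) f_S]. *)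
Definition fS_coef n : R := ((n == 0%N) || (n \in S))%:R.
Definition hS_coef n : R := fS_coef n - (if n is n'.+1 then fS_coef n' else 0).
Definition hS n : R[i] := ((hS_coef n)%:C)%C.

Lemma notin_S0 : (0%N \in S) = false.
Proof. by apply/negP; rewrite inE => /S_pos. Qed.

Lemma normc_hS_le1 n : normc (hS n) <= 1.
Proof.
rewrite normc_real /hS_coef; case: n => [|n]; rewrite /fS_coef.
  by rewrite subr0 eqxx normr1.
by case: (_ || _); case: (_ || _); rewrite ?subrr ?subr0 ?sub0r ?normrN ?normr0 ?normr1.
Qed.

Lemma fS_coef_CS n :
  \sum_(i < n.+1) ((fS_coef i)%:C)%C * (CS R S (n - i) : R[i]) = 1.
Proof.
rewrite -(CS_rec R S_pos n) [in RHS]big_ord_recl /= notin_S0 mul0r add0r.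
rewrite big_ord_recl /= subn0 /fS_coef /= rmorph1 mul1r; congr (_ + _).
by apply: eq_bigr => i _; rewrite rmorph_nat.
Qed.

(** The convolutions with [fS_coef] are constantly 1; multiplying by 1 - q takes differences,
    leaving only degree 0. *)
Lemma hS_CS n : \sum_(i < n.+1) hS i * (CS R S (n - i) : R[i]) = (n == 0%N)%:R.
Proof.
rewrite /hS /hS_coef.
under eq_bigr do rewrite rmorphB mulrBl.
rewrite sumrB fS_coef_CS big_ord_recl /= rmorph0 mul0r add0r.
case: n => [|n]; first by rewrite big_ord0 subr0.
under eq_bigr do rewrite subSS.
by rewrite fS_coef_CS subrr.
Qed.

Lemma series_horner (z : R[i]) N :
  series (fun n => (n \in S)%:R * z ^+ n : Cplx R) N =
  (\poly_(i < N) (i \in S)%:R : {poly R[i]}).[z].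
Proof. by rewrite horner_poly /series /= big_mkord. Qed.

Lemma trunc_hSE (z : R[i]) N : (\poly_(i < N.+1) hS i).[z] =
  (1 - z) * (1 + (\poly_(i < N.+1) (i \in S)%:R : {poly R[i]}).[z])
  + ((fS_coef N)%:C)%C * z ^+ N.+1.
Proof.
rewrite !horner_poly; elim: N => [|N IH].
  rewrite !big_ord1 notin_S0 /hS /hS_coef /fS_coef /= subr0 rmorph1; ring.
rewrite big_ord_recr /= IH [in RHS]big_ord_recr /= /hS /hS_coef rmorphB /=.
have -> : ((fS_coef N.+1)%:C)%C = (N.+1 \in S)%:R by rewrite /fS_coef /= rmorph_nat.
by rewrite !exprS; ring.
Qed.

Lemma normc_mem_le1 n : normc ((n \in S)%:R : R[i]) <= 1.
Proof. by rewrite normc_nat; case: (n \in S). Qed.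

Lemma fS_pseries_lim (z : R[i]) :
  fS S (z : Cplx R) = 1 + pseries_lim (fun n => (n \in S)%:R) z.
Proof.
rewrite /fS /pseries_lim; congr (_ + limn _).
by apply/funext => N; exact: series_horner.
Qed.

Lemma pseries_lim_hS (z : R[i]) : normc z < 1 ->
  pseries_lim hS z = (1 - z) * (fS S (z : Cplx R) : R[i]).
Proof.
move=> z1; apply: cvg_lim => //; apply/cvgn_complexP => e e0.
have z01 : 0 <= normc z < 1 by rewrite normc_ge0.
(* The 2 bounds |1 - z| in front of the tail, and the added 1 bounds the coefficient of the boundary
   term. *)
have [N1 HN1] := @expr_eventually_le _ (normc z) (2 / (1 - normc z) + 1) _ z01 e0.
exists N1.+1 => -[//|N] le_N.
rewrite trunc_hSE fS_pseries_lim.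
set p := (horner _ _); set l := pseries_lim _ _ : R[i].
have -> : (1 - z) * (1 + l) - ((1 - z) * (1 + p) + ((fS_coef N)%:C)%C * z ^+ N.+1) =
  (1 - z) * (l - p) - ((fS_coef N)%:C)%C * z ^+ N.+1 :> R[i] by ring.
apply: le_trans (le_normcD _ _) _; rewrite normcN !normcM normcX.
apply: le_trans (HN1 _ (ltnW le_N)); rewrite mulrDl mul1r; apply: lerD.
  rewrite -mulrA [X in _ <= 2 * X]mulrC; apply: ler_pM; rewrite ?normc_ge0 //.
    apply: le_trans (le_normcD _ _) _; rewrite normcN normc1.
    by rewrite (_ : 2 = 1 + 1 :> R) ?lerD2l ?ltW.
  by apply: pseries_dist_le => //; exact: normc_mem_le1.
rewrite -[leRHS]mul1r ler_wpM2r ?exprn_ge0 ?normc_ge0 // normc_real /fS_coef.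
by case: (_ || _); rewrite ?normr0 ?normr1.
Qed.

Lemma CS_growth :
    (forall q, @unit_disk R q -> fS S q != 0) ->
  forall T : R, 0 < T -> T < 1 -> exists K, forall n, normc (CS R S n : R[i]) * T ^+ n <= K.
Proof.
move=> fS_neq0; apply: (@inverse_series_growth R hS (CS R S) normc_hS_le1 hS_CS).
  by rewrite /hS /hS_coef /fS_coef /= subr0 rmorph1.
move=> T T0 T1; apply: trunc_lower_bound => //; first exact: normc_hS_le1.
move=> z z1; rewrite pseries_lim_hS // mulf_neq0 //.
  rewrite subr_eq0; apply: contraTneq z1 => <-.
  by rewrite normc1 ltxx.
by apply: fS_neq0; rewrite /unit_disk /= normc_normr ltcR.
Qed.

Lemma normc_ofR (r : R) : 0 <= r -> normc (ofR r : R[i]) = r.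
Proof. by move=> r0; rewrite normc_real ger0_norm. Qed.

Lemma FS_seriesE (q : Cplx R) N :
  FS_series S q N = (\poly_(i < N) (CS R S i : R[i])).[q].
Proof. by rewrite horner_poly /FS_series /series /= big_mkord. Qed.

Lemma FS_cvg : (forall q, @unit_disk R q -> fS S q != 0) ->
  forall r : R, 0 <= r < 1 -> cvgn (FS_series S (ofR r)).
Proof.
move=> fS_neq0 r /andP[r0 r1].
(* Any T strictly between r and 1 would do: the series is then dominated by a geometric one of ratio
   r/T. *)
have [T TE] : exists T, T = (r + 1) / 2 by eexists.
have T0 : 0 < T by rewrite TE; lra.
have T1 : T < 1 by rewrite TE; lra.
have rT : r < T by rewrite TE; lra.
have [K HK] := CS_growth fS_neq0 T0 T1.
have x01 : 0 <= r / T < 1 by rewrite divr_ge0 ?(ltW T0) //= ltr_pdivrMr ?mul1r.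
apply: (@complex_cauchy_cvgn _ _ (fun N => K * (r / T) ^+ N / (1 - r / T))).
  move=> N n le_Nn; rewrite !FS_seriesE !horner_poly.
  apply: (sum_tail_le (u := fun i => CS R S i * ofR r ^+ i) le_Nn x01) => i.
  rewrite normcM normcX normc_ofR // expr_div_n mulrA ler_pdivlMr ?exprn_gt0 //.
  by rewrite mulrAC ler_wpM2r // exprn_ge0.
move=> e e0.
have [N /(_ N (leqnn N)) HN] := expr_eventually_le (K / (1 - r / T)) x01 e0.
by exists N; rewrite mulrAC.
Qed.

(** The product of the two truncations differs from 1 by the truncation error, which the growth
    bound sends to 0 at radius r. *)
Lemma FS_mul_lim : (forall q, @unit_disk R q -> fS S q != 0) ->
  forall r : R, 0 <= r < 1 -> (FS S (ofR r) : R[i]) * pseries_lim hS (ofR r) = 1.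
Proof.
move=> fS_neq0 r /[dup] r01 /andP[r0 r1].
have [T TE] : exists T, T = (r + 1) / 2 by eexists.
have T0 : 0 < T by rewrite TE; lra.
have T1 : T < 1 by rewrite TE; lra.
have rT : 0 <= r < T by rewrite r0 TE /=; lra.
have [K HK] := CS_growth fS_neq0 T0 T1.
have H1 : FS_series S (ofR r) @ \oo --> FS S (ofR r) by exact: FS_cvg.
have H2 := @pseries_cvg R hS normc_hS_le1 (ofR r).
have r1C : normc (ofR r : R[i]) < 1 by rewrite normc_ofR.
have H3 := cvgM H1 (H2 r1C).
suff H4 : FS_series S (ofR r) N * ((\poly_(i < N) hS i).[ofR r] : Cplx R)
    @[N --> \oo] --> (1 : Cplx R) by exact: (cvg_unique (@norm_hausdorff _ _) (H3 _) H4).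
apply/cvgn_complexP => e e0.
have [N1 HN1] := wnorm_trunc_err_small normc_hS_le1 hS_CS rT (ltW T1) HK e0.
exists N1 => N le_N; apply: le_trans (HN1 N le_N).
(* Order 0 and t = 0: the weighted norm at radius r bounds the value at r. *)
have := nderivn_le_wnorm (\poly_(i < N) hS i * \poly_(i < N) (CS R S i : R[i]) - 1)
  0 (ofR r) (lexx 0).
rewrite nderivn0 mulr1 addr0 normc_ofR // !hornerE; apply: le_trans.
by rewrite /= FS_seriesE normc_distC mulrC.
Qed.

Lemma sum_fS_coef N :
  \sum_(i < N.+1) fS_coef i = 1 + N%:R * density_ratio R S N.
Proof.
have -> : N%:R * density_ratio R S N = \sum_(i < N.+1) ((i : nat) \in S)%:R.
  have cntE : #|[pred k : 'I_N.+1 | (k : nat) \in S]|%:R =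
      \sum_(i < N.+1) ((i : nat) \in S)%:R :> R.
    rewrite -sum1_card natr_sum big_mkcond /=; apply: eq_bigr => i _.
    by rewrite inE; case: (_ \in _).
  rewrite /density_ratio cntE; case: N {cntE} => [|N].
    by rewrite mul0r big_ord1 notin_S0.
  by rewrite mulrC divfK // pnatr_eq0.
rewrite big_ord_recl [in RHS]big_ord_recl /= notin_S0 add0r /fS_coef /=.
by congr (_ + _); apply: eq_bigr => i _.
Qed.

(** Existence of the density makes the centred partial sums o(n); the finitely many early deviations
    go into K. *)
Lemma partial_sums_bound : cvgn (density_ratio R S) -> forall e : R, 0 < e ->
  exists2 K, 0 <= K &
    forall n, `|\sum_(i < n) (fS_coef i - density R S)| <= e * n%:R + K.
Proof.
set d := density R S => dS e e0.
have /cvgrPdist_le /(_ e e0) [N1 _ HN1] : density_ratio R S @ \oo --> d by [].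
pose K1 := \sum_(m < N1) m%:R * `|density_ratio R S m - d|.
have K10 : 0 <= K1 by apply: sumr_ge0 => m _; rewrite mulr_ge0.
exists (`|1 - d| + K1); first by rewrite addr_ge0.
case=> [|N]; first by rewrite big_ord0 normr0 mulr0 add0r addr_ge0.
rewrite sumrB sumr_const card_ord sum_fS_coef -[d *+ _]mulr_natr -natr1.
(* The constant term of f_S and the shift between N and N + 1 together leave 1 - d. *)
have -> : 1 + N%:R * density_ratio R S N - d * (N%:R + 1) =
  (1 - d) + N%:R * (density_ratio R S N - d) by ring.
apply: le_trans (ler_normD _ _) _; rewrite addrCA lerD2l normrM normr_nat.
have [lt_N|le_N] := ltnP N N1.
  rewrite -[leLHS]add0r; apply: lerD; first by rewrite mulr_ge0 ?addr_ge0 // ltW.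
  rewrite /K1 (bigD1 (Ordinal lt_N)) //= lerDl.
  by apply: sumr_ge0 => m _; rewrite mulr_ge0.
rewrite -[leLHS]addr0; apply: lerD => //; rewrite mulrDr mulr1.
apply: le_trans (_ : N%:R * e <= _).
  by apply: ler_wpM2l => //; rewrite distrC; exact: HN1.
by rewrite mulrC lerDl ltW.
Qed.

Lemma horner_hS_ofR (r : R) N : (\poly_(i < N.+1) hS i).[(ofR r : R[i])] =
  (((1 - r) * \sum_(i < N.+1) fS_coef i * r ^+ i + fS_coef N * r ^+ N.+1)%:C)%C.
Proof.
rewrite trunc_hSE horner_poly rmorphD !rmorphM rmorphB rmorph1 rmorphXn /=.
congr (_ * _ + _); rewrite big_ord_recl [in RHS]big_ord_recl /= notin_S0 mul0r add0r.
have -> : fS_coef 0 * r ^+ 0 = 1 by rewrite /fS_coef eqxx mulr1.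
rewrite rmorphD rmorph1; congr (_ + _).
rewrite rmorph_sum; apply: eq_bigr => i _.
by rewrite rmorphM rmorphXn rmorph_nat.
Qed.

Lemma pseries_lim_hS_near1 : cvgn (density_ratio R S) ->
  pseries_lim hS (ofR r) @[r --> (1 : R)^'-] --> ofR (density R S).
Proof.
move=> dS; set d := density R S; apply/cvg_complexP => e e0.
have e30 : 0 < e / 3 by rewrite divr_gt0.
have [K K0 HK] := partial_sums_bound dS e30.
(* For r within [eta] of 1, K (1 - r) is at most e/3; K + 1 avoids dividing by zero. *)
have [eta etaE] : exists eta, eta = e / 3 / (K + 1) by eexists.
have K1 : 0 < K + 1 by rewrite ltr_wpDl.
have eta0 : 0 < eta by rewrite etaE divr_gt0.
near=> r.
have r1 : r < 1 by near: r; exact: nbhs_left_lt.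
have r0 : 0 <= r by near: r; apply: nbhs_left_ge; exact: ltr01.
have r_eta : 1 - eta <= r by near: r; apply: nbhs_left_ge; rewrite gtrBl.
have r01 : 0 <= r < 1 by rewrite r0.
(* The point r is fixed before N grows, so [N1] may depend on r. *)
have [N1 HN1] := expr_eventually_le (`|d| + 1) r01 e30.
rewrite normc_distC.
have r1C : normc (ofR r : R[i]) < 1 by rewrite normc_ofR.
apply: (lim_dist_le (N := N1.+1) (pseries_cvg normc_hS_le1 r1C)) => -[//|N] le_N.
rewrite horner_hS_ofR -rmorphB normc_real.
(* Since (1 - r) times the geometric sum is 1 - r^(N+1), d can be moved inside the sum at the cost
   of a boundary term. *)
have -> : (1 - r) * \sum_(i < N.+1) fS_coef i * r ^+ i + fS_coef N * r ^+ N.+1 - d =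
    (1 - r) * (\sum_(i < N.+1) (fS_coef i - d) * r ^+ i) + (fS_coef N - d) * r ^+ N.+1.
  have -> : \sum_(i < N.+1) (fS_coef i - d) * r ^+ i =
      \sum_(i < N.+1) fS_coef i * r ^+ i - d * \sum_(i < N.+1) r ^+ i.
    by rewrite mulr_sumr -sumrB; apply: eq_bigr => i _; rewrite mulrBl.
  have geo : (1 - r) * \sum_(i < N.+1) r ^+ i = 1 - r ^+ N.+1.
    by rewrite -opprB mulNr -subrX1 opprB.
  by rewrite mulrBr mulrCA geo; ring.
apply: le_trans (ler_normD _ _) _.
have H1 := abel_bound (b := fun i => fS_coef i - d) N.+1 r01 HK.
have H2 : `|(fS_coef N - d) * r ^+ N.+1| <= e / 3.
  apply: le_trans (HN1 _ (ltnW le_N)).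
  rewrite normrM (ger0_norm (exprn_ge0 _ r0)) ler_wpM2r ?exprn_ge0 //.
  apply: le_trans (ler_normB _ _) _; rewrite addrC lerD2l /fS_coef.
  by case: (_ || _); rewrite ?normr0 ?normr1.
have H3 : (1 - r ^+ N.+1) * (e / 3) <= e / 3.
  by rewrite ler_piMl ?(ltW e30) // gerBl exprn_ge0.
have H4 : K * (1 - r) <= e / 3.
  apply: le_trans (_ : (K + 1) * eta <= _); last by rewrite etaE mulrC divfK ?gt_eqF.
  by apply: ler_pM => //; lra.
apply: (le_trans (lerD (le_trans H1 (lerD H3 H4)) H2)); lra.
Unshelve. all: by end_near.
Qed.

End DensitySeries.

(** * The radial limit *)

Theorem theorem1 (R : realType) (S : set nat)
    (S_pos : S `<=` [set n | (0 < n)%N])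
    (dS_exists : cvgn (density_ratio R S))
    (dS_gt0 : 0 < density R S)
    (fS_analytic : analytic_on (@unit_disk R) (fS S))
    (fS_neq0 : forall q, @unit_disk R q -> fS S q != 0) :
  (forall r : R, 0 <= r < 1 -> cvgn (FS_series S (ofR r))) /\
  FS S (ofR r) @[r --> 1^'-] --> ofR (1 / density R S).
Proof.
split; first exact: FS_cvg.
have d0 : ofR (density R S) != 0 :> Cplx R.
  by rewrite /ofR fmorph_eq0 gt_eqF.
have -> : ofR (1 / density R S) = (ofR (density R S))^-1.
  by rewrite /ofR div1r fmorphV.
(* Near 1 from the left, F_S is the pointwise inverse of (1 - r) f_S(r), whose limit d is
   nonzero. *)
apply: cvg_trans (cvgV d0 (pseries_lim_hS_near1 S_pos dS_exists)).
apply: near_eq_cvg; near=> r.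
have r01 : 0 <= r < 1.
  apply/andP; split; near: r; first by apply: nbhs_left_ge; exact: ltr01.
  exact: nbhs_left_lt.
have eq1 := FS_mul_lim S_pos fS_neq0 r01.
have nz : pseries_lim (hS R S) (ofR r) != 0.
  by apply: contra_eq_neq eq1 => ->; rewrite mulr0 eq_sym oner_neq0.
by apply: (mulIf nz); rewrite mulVf // eq1.
Unshelve. all: by end_near.
Qed.
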